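(* For every $\varepsilon>0$ there exist constants $p_0=p_0(\varepsilon)$ and $c=c(\varepsilon)>0$, depending only on $\varepsilon$, such that for every prime $p\ge p_0$ and all (nonempty) intervals $\mathcal{I}_1,\mathcal{I}_2,\mathcal{I}_3$ in $\mathbb{F}_p^*$ with $|\mathcal{I}_i|<p^{1/8}$ for $i=1,2,3$, $$c\,\bigl(|\mathcal{I}_1|\cdot|\mathcal{I}_2|\cdot|\mathcal{I}_3|\bigr)^{1-\varepsilon}\le |\mathcal{I}_1\cdot\mathcal{I}_2\cdot\mathcal{I}_3|\le |\mathcal{I}_1|\cdot|\mathcal{I}_2|\cdot|\mathcal{I}_3| .$$ (That is, $|\mathcal{I}_1\cdot\mathcal{I}_2\cdot\mathcal{I}_3|=(|\mathcal{I}_1|\cdot|\mathcal{I}_2|\cdot|\mathcal{I}_3|)^{1-o(1)}$.)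
   Context: $\mathbb{F}_p$ is the field of residue classes modulo the prime $p$ and $\mathbb{F}_p^*=\mathbb{F}_p\setminus\{0\}$. An interval in $\mathbb{F}_p^*$ is a set of residue classes of consecutive integers $L+1,\dots,L+N$ (with $L\in\mathbb{Z}$, $1\le N<p$), none of which is divisible by $p$; its length $|\mathcal{I}|$ is its number of elements $N$. The product set is $\mathcal{I}_1\cdot\mathcal{I}_2\cdot\mathcal{I}_3=\{xyz: x\in\mathcal{I}_1,\,y\in\mathcal{I}_2,\,z\in\mathcal{I}_3\}\subset\mathbb{F}_p^*$. *)

(* Defs.v *)
From mathcomp Require Import all_boot all_order all_algebra.

Set Implicit Arguments.
Unset Strict Implicit.
Unset Printing Implicit Defensive.

Import GRing.Theory.
Local Open Scope ring_scope.

(* Ordinals i : 'I_N start at 0, so the integers below are L + 1, ..., L + N. *)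
Definition consecutive_residues (p : nat) (L : int) (N : nat) : {set 'F_p} :=
  [set (L + i.+1%:Z)%:~R | i : 'I_N].

(* As 1 <= N < p makes the N residues distinct, the length of the interval
   is its cardinality #|I|. *)
Definition is_Fp_interval (p : nat) (I : {set 'F_p}) : Prop :=
  exists (L : int) (N : nat),
    [/\ (1 <= N < p)%N,
        forall i : 'I_N, ~~ (p%:Z %| L + i.+1%:Z)%Z
      & I = consecutive_residues p L N].

Definition prodset3 (p : nat) (A B C : {set 'F_p}) : {set 'F_p} :=
  [set w | [exists x in A, exists y in B, exists z in C, w == x * y * z]].

Arguments is_Fp_interval p I : clear implicits.
Arguments prodset3 p A B C : clear implicits.

(* Main.v *)
Require Import Defs.
From mathcomp Require Import all_boot all_order all_algebra.
From mathcomp Require Import all_classical all_reals all_analysis.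
From mathcomp Require Import zify ring.

(* For intervals I = L + [0, H] with 144 H^8 < p, consider the solutions of
   f_x(L) := (L + x_1)(L + x_2)(L + x_3) = b mod p with all x_i in [0, H].
   Differences f_x - f_y are quadratic polynomials with small coefficients
   vanishing at L mod p, so the resultant of two of them and the determinant
   of three of them are multiples of p too small to be nonzero.  Hence either
   these differences are all proportional, or the cross product of two
   independent ones gives a rational number that plays the role of L over Q.  In
   both cases there are an integer polynomial q of degree 1 or 2 and an
   integer n, polynomially bounded in H, with q(x_1) q(x_2) q(x_3) = n for
   all solutions x.  Either n = 0, and some x_i is one of the at most two
   roots of q, or each q(x_i) is one of the H^o(1) divisors of n.
   So some coordinate takes only H^o(1) values; the same argument in two
   variables then bounds the number of solutions by H^o(1).

   This bounds the multiplicative energy of each interval by its length to the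
   power 3 + o(1); a Hoelder inequality for the mixed energy of three
   intervals and Cauchy-Schwarz bound the product set from below.  Halving the
   intervals, which only shrinks the product set, provides the constant needed
   for 144 H^8 < p. *)

Set Implicit Arguments.
Unset Strict Implicit.
Unset Printing Implicit Defensive.

Import Order.TTheory GRing.Theory Num.Theory.

(** * The divisor bound *)

(** [divisors] folds over the prime factorisation; for the factor [(p, e)] each of [e] merging steps
    adds the length of the old list once more. *)
Lemma size_divisors (n : nat) :
  size (divisors n) = \prod_(f <- prime_decomp n) f.2.+1.
Proof.
rewrite /divisors; elim: (prime_decomp n) => [|[p e] s IHs]; first by rewrite big_nil.
rewrite big_cons -IHs /=; elim: e => [|e IHe] /=; first by rewrite mul1n.
by rewrite size_merge size_cat size_map IHe [RHS]mulSnr.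
Qed.

(** With m the integer part of e / k, one has e + 1 <= k (m + 1) <= k 2^m; take k-th powers. *)
Lemma expnS_le_exp2 (k e : nat) : 0 < k -> e.+1 ^ k <= k ^ k * 2 ^ e.
Proof.
move=> k_gt0; have le_e: e.+1 <= k * 2 ^ (e %/ k).
  apply: (@leq_trans (k * (e %/ k).+1)); first by rewrite mulnC ltn_ceil.
  by rewrite leq_mul2l ltn_expl ?orbT.
have: e.+1 ^ k <= (k * 2 ^ (e %/ k)) ^ k by rewrite leq_exp2r.
move/leq_trans; apply; rewrite expnMn -expnM leq_mul2l leq_exp2l //.
by rewrite leq_divM orbT.
Qed.

(* Only the boundedly many primes below [2 ^ k] can contribute more than
   [p ^ e] to the product. *)
Lemma size_divisors_bound (k : nat) : 0 < k ->
  exists C : nat, forall n : nat, 0 < n -> size (divisors n) ^ k <= C * n.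
Proof.
move=> k_gt0; set B := k ^ k.
have B_gt0 : 0 < B by rewrite expn_gt0 k_gt0.
exists (B ^ 2 ^ k) => n n_gt0.
have expn_prod (s : seq (nat * nat)) :
    (\prod_(f <- s) f.2.+1) ^ k = \prod_(f <- s) f.2.+1 ^ k.
  by rewrite (big_morph (fun m => m ^ k) (fun a b => expnMn a b k) (exp1n k)).
rewrite size_divisors expn_prod {2}(prod_prime_decomp n_gt0).
apply: (@leq_trans (\prod_(f <- prime_decomp n)
    ((if f.1 < 2 ^ k then B else 1) * f.1 ^ f.2))).
  rewrite big_seq [X in _ <= X]big_seq; apply: leq_prod.
  move=> -[p e] /mem_prime_decomp[p_pr e_gt0 _] /=.
  case: ifP => [_|/negbT]; last first.
    (* For p >= 2^k, already (e + 1)^k <= 2^(k e) <= p^e. *)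
    rewrite -leqNgt mul1n => le_p; apply: (@leq_trans ((2 ^ k) ^ e)).
      by rewrite -expnM mulnC expnM leq_exp2r // ltn_expl.
    by rewrite leq_exp2r.
  apply: leq_trans (expnS_le_exp2 _ k_gt0) _.
  by rewrite leq_mul2l leq_exp2r ?prime_gt1 ?orbT.
rewrite big_split /= leq_mul2r; apply/orP; right.
rewrite -big_mkcond /= -(big_map fst (fun p => p < 2 ^ k) (fun=> B)) -big_filter.
rewrite big_const_seq count_predT iter_muln_1.
apply: leq_pexp2l => //; rewrite -[leqRHS](size_iota 0); apply: uniq_leq_size.
  by rewrite filter_uniq // primes_uniq.
by move=> p; rewrite mem_filter mem_iota => /andP[].
Qed.

Local Open Scope ring_scope.

(** * Product equations in short intervals *)

(** Distinct roots u, v satisfy a (u + v) + b = 0; two such relations sharing a root, as three roots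
    would give, force a = 0 and then b = 0. *)
Lemma quadratic_roots (a b c : int) : (a != 0) || (b != 0) ->
  exists s : seq int, (size s <= 2)%N /\
    forall x, a * x ^+ 2 + b * x + c = 0 -> x \in s.
Proof.
move=> nz_ab; set q := fun x : int => a * x ^+ 2 + b * x + c.
have [[x0 qx0]|no_root] := pselect (exists x0, q x0 = 0); last first.
  by exists [::]; split=> // x qx; case: no_root; exists x.
have [[x1 [qx1 x10]]|no_root] := pselect (exists x1, q x1 = 0 /\ x1 != x0); last first.
  exists [:: x0]; split=> // x qx; rewrite inE.
  by apply: contra_notT no_root => x_neq; exists x.
exists [:: x0; x1]; split=> // x qx; rewrite !inE; apply: contraLR nz_ab.
rewrite !negb_or !negbK => /andP[x_x0 x_x1].
have slope (u v : int) : q u = 0 -> q v = 0 -> u != v -> a * (u + v) + b = 0.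
  move=> qu qv; rewrite -subr_eq0 => uv.
  apply/eqP; rewrite -(mulrI_eq0 _ (mulfI uv)); apply/eqP.
  by rewrite -[RHS](subrr 0) -{1}qu -qv /q; ring.
have e1 := slope _ _ qx1 qx0 x10; have e2 := slope _ _ qx qx0 x_x0.
have a0 : a = 0.
  apply/eqP; move: x_x1; rewrite -subr_eq0 => /mulfI xI.
  by rewrite -(mulrI_eq0 _ xI); apply/eqP; lia.
by rewrite a0 eqxx /=; apply/eqP; move: e1; rewrite a0; lia.
Qed.

Lemma quadratic_preimage (a b c : int) (ds : seq int) : (a != 0) || (b != 0) ->
  exists s : seq int, (size s <= 2 * size ds)%N /\
    forall x, a * x ^+ 2 + b * x + c \in ds -> x \in s.
Proof.
move=> nz_ab; elim: ds => [|d ds [s [size_s mem_s]]]; first by exists [::].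
have [t [size_t mem_t]] := quadratic_roots (c - d) nz_ab.
exists (t ++ s); split=> [|x]; first by rewrite size_cat mulnS leq_add.
rewrite inE mem_cat => /orP[/eqP qx|/mem_s ->]; last by rewrite orbT.
by rewrite mem_t // addrA qx subrr.
Qed.

(** For n nonzero the first factor is a divisor of n up to sign: the 4 counts two signs and two
    preimages of each value. The 2 covers n = 0, where some entry is a root. *)
Lemma quadratic_prod_eq (a b c n : int) : (a != 0) || (b != 0) ->
  exists s : seq int, (size s <= 4 * size (divisors `|n|) + 2)%N /\
    forall xs, xs != [::] -> \prod_(x <- xs) (a * x ^+ 2 + b * x + c) = n ->
      has [in s] xs.
Proof.
move=> nz_ab; have [->|n_neq0] := eqVneq n 0.
  have [s [size_s mem_s]] := quadratic_roots c nz_ab.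
  exists s; split=> [|xs _ /eqP]; first exact: leq_trans size_s (leq_addl _ _).
  rewrite prodf_seq_eq0 => /hasP[x x_xs /eqP/mem_s x_s].
  by apply/hasP; exists x.
set D := divisors _.
have [s [size_s mem_s]] := quadratic_preimage c
  ([seq d%:Z | d <- D] ++ [seq - d%:Z | d <- D]) nz_ab.
exists s; split=> [|[//|x xs] _].
  by apply: (leq_trans size_s); rewrite size_cat !size_map; lia.
rewrite big_cons /= => def_n; apply/orP; left; apply: mem_s.
set q := _ + c; have q_dvd : (`|q| \in D)%N.
  by rewrite -dvdn_divisors ?absz_gt0 // -[(_ %| _)%N]/(q %| n)%Z -def_n dvdz_mulr.
rewrite mem_cat; case: (ger0P q) => q_sgn; apply/orP; [left|right].
  by apply/mapP; exists `|q|%N => //; lia.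
by apply/mapP; exists `|q|%N => //; lia.
Qed.

(** * From congruences modulo p to integer equations *)

Lemma dvdz_small_eq0 (p z : int) : (p %| z)%Z -> `|z| < p -> z = 0.
Proof.
move=> /dvdzP[q ->] lt_p; have p_gt0 : 0 < p by apply: le_lt_trans lt_p.
move: lt_p; rewrite normrM (gtr0_norm p_gt0) -[X in _ < X]mul1r ltr_pM2r //.
move=> q_lt1; have -> : q = 0 by lia.
by rewrite mul0r.
Qed.

Lemma normM_le (a b A B : int) : `|a| <= A -> `|b| <= B -> `|a * b| <= A * B.
Proof. by move=> le_a le_b; rewrite normrM ler_pM. Qed.

Lemma normB_le (a b A B : int) : `|a| <= A -> `|b| <= B -> `|a - b| <= A + B.
Proof. by move=> le_a le_b; apply: le_trans (ler_normB _ _) (lerD le_a le_b). Qed.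

Lemma normD_le (a b A B : int) : `|a| <= A -> `|b| <= B -> `|a + b| <= A + B.
Proof. by move=> le_a le_b; apply: le_trans (ler_normD _ _) (lerD le_a le_b). Qed.

(** The condition [0 < i] is there for [h = 0], whose power 0 is 1. *)
Lemma exp_nat_le (h i j : nat) : (0 < i <= j)%N -> (h%:Z ^+ i <= h%:Z ^+ j).
Proof.
case: h => [|h] /andP[i_gt0 le_ij]; last exact: ler_weXn2l.
by case: i j i_gt0 le_ij => [|i] [|j] // _ _; rewrite !expr0n.
Qed.

(* [(u, v, w)] is the cross product of two independent elements of [V]; then
   [v ^+ 2 - u * w] is, up to sign, the resultant of the two corresponding
   quadratics, and a third element of [V] gives a vanishing 3x3 determinant. *)
Lemma small_solutions (p H : nat) (L : int) (V : int -> int -> int -> Prop) :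
  (144 * H ^ 8 < p)%N ->
  (forall a b c, V a b c -> [/\ `|a| <= 3 * H%:Z, `|b| <= 3 * H%:Z ^+ 2,
     `|c| <= H%:Z ^+ 3 & (p%:Z %| a * L ^+ 2 + b * L + c)%Z]) ->
  [\/ forall a b c, V a b c -> [/\ a = 0, b = 0 & c = 0],
      exists a b c, [/\ V a b c, (a != 0) || (b != 0) &
        forall a' b' c', V a' b' c' ->
          [/\ a * b' = a' * b, a * c' = a' * c & b * c' = b' * c]]
    | exists u v w : int, [/\ w != 0, `|w| <= 18 * H%:Z ^+ 3, `|v| <= 6 * H%:Z ^+ 4,
        v ^+ 2 = u * w &
        forall a b c, V a b c -> u * a + v * b + w * c = 0]].
Proof.
move=> lt_p V_small; set h := H%:Z.
have {}lt_p : 144 * h ^+ 8 < p%:Z by rewrite /h; lia.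
have h_ge0 : 0 <= h by [].
have pow i : (0 < i <= 8)%N -> h ^+ i <= h ^+ 8 by exact: exp_nat_le.
have [zero|nz] := pselect (forall a b c, V a b c -> [/\ a = 0, b = 0 & c = 0]).
  by constructor 1.
have eq0 a b c : V a b c -> a = 0 -> b = 0 -> c = 0.
  move=> /V_small[_ _ le_c +] a0 b0; rewrite a0 b0 !mul0r !add0r => /dvdz_small_eq0.
  apply; apply: le_lt_trans le_c _; apply: le_lt_trans lt_p.
  by rewrite -[leLHS]mul1r ler_pM ?exprn_ge0 ?pow.
have eq01 a b c a' b' c' : V a b c -> V a' b' c' -> a = 0 -> a' = 0 -> b * c' = b' * c.
  move=> /V_small[_ le_b le_c +] /V_small[_ le_b' le_c' +] a0 a'0.
  rewrite a0 a'0 !mul0r !add0r => /dvdzP[q def_q] /dvdzP[q' def_q'].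
  apply/eqP; rewrite -subr_eq0; apply/eqP; apply: (@dvdz_small_eq0 p%:Z).
    apply/dvdzP; exists (b * q' - b' * q).
    by rewrite mulrBl -!mulrA -def_q -def_q'; ring.
  apply: le_lt_trans (normB_le (normM_le le_b le_c') (normM_le le_b' le_c)) _.
  rewrite (_ : _ + _ = 6 * h ^+ 5); last by rewrite /h; ring.
  by apply: le_lt_trans lt_p; rewrite ler_pM ?exprn_ge0 ?pow.
have [a [b [c [Vabc nz_ab]]]] : exists a b c, V a b c /\ (a != 0) || (b != 0).
  apply: contrapT => no; apply: nz => a b c Vabc.
  have [a0 b0] : a = 0 /\ b = 0.
    apply: contrapT => ab; apply: no; exists a, b, c; split=> //.
    by rewrite -negb_and; apply/negP => /andP[/eqP ? /eqP ?]; apply: ab.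
  by split=> //; apply: eq0 Vabc _ _.
have [prop|not_prop] := pselect (forall a' b' c', V a' b' c' ->
    [/\ a * b' = a' * b, a * c' = a' * c & b * c' = b' * c]).
  by constructor 2; exists a, b, c.
constructor 3.
have [a' [b' [c' [Vabc' nprop]]]] : exists a' b' c', V a' b' c' /\
    ~ [/\ a * b' = a' * b, a * c' = a' * c & b * c' = b' * c].
  apply: contrapT => no; apply: not_prop => a' b' c' V'; apply: contrapT => ?.
  by apply: no; exists a', b', c'.
have [le_a le_b le_c /dvdzP[q def_q]] := V_small _ _ _ Vabc.
have [le_a' le_b' le_c' /dvdzP[q' def_q']] := V_small _ _ _ Vabc'.
have def_c : c = q * p%:Z - a * L ^+ 2 - b * L by rewrite -def_q; ring.
have def_c' : c' = q' * p%:Z - a' * L ^+ 2 - b' * L by rewrite -def_q'; ring.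
pose u := b * c' - b' * c; pose v := a' * c - a * c'; pose w := a * b' - a' * b.
have le_u : `|u| <= 6 * h ^+ 5.
  apply: le_trans (normB_le (normM_le le_b le_c') (normM_le le_b' le_c)) _.
  by rewrite (_ : _ + _ = 6 * h ^+ 5) // /h; ring.
have le_v : `|v| <= 6 * h ^+ 4.
  apply: le_trans (normB_le (normM_le le_a' le_c) (normM_le le_a le_c')) _.
  by rewrite (_ : _ + _ = 6 * h ^+ 4) // /h; ring.
have le_w : `|w| <= 18 * h ^+ 3.
  apply: le_trans (normB_le (normM_le le_a le_b') (normM_le le_a' le_b)) _.
  by rewrite (_ : _ + _ = 18 * h ^+ 3) // /h; ring.
(* Both quadratics vanish at L modulo p, so p divides this resultant. Its size is at most (36 + 108)
   h^8, the source of the constant 144. *)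
have v2 : v ^+ 2 = u * w.
  apply/eqP; rewrite -subr_eq0; apply/eqP; apply: (@dvdz_small_eq0 p%:Z).
    pose r := a * q' - a' * q; pose s := b * q' - b' * q.
    apply/dvdzP; exists (p%:Z * r ^+ 2 - L * r * w *+ 2 - w * s).
    by rewrite /u /v /w /r /s def_c def_c'; ring.
  apply: le_lt_trans (normB_le (normM_le le_v le_v) (normM_le le_u le_w)) _.
  by rewrite (_ : _ + _ = 144 * h ^+ 8) //; ring.
exists u, v, w; split=> // [|A B C VABC].
  (* If w = 0, then v = 0, and orthogonality gives a u = a' u = 0. A nonzero u would thus force a =
     a' = 0, where [eq01] yields u = 0. So the cross product vanishes, against independence. *)
  apply/eqP => w0; have v0 : v = 0.
    by apply/eqP; rewrite -sqrf_eq0 v2 w0 mulr0.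
  apply: nprop; suff u0 : u = 0.
    by split; apply/eqP; rewrite -subr_eq0;
      [rewrite -/w w0 | rewrite -oppr_eq0 opprB -/v v0 | rewrite -/u u0].
  have au : a * u = 0.
    have -> : a * u = - b * v - c * w by rewrite /u /v /w; ring.
    by rewrite v0 w0 !mulr0 subr0.
  have au' : a' * u = 0.
    have -> : a' * u = - b' * v - c' * w by rewrite /u /v /w; ring.
    by rewrite v0 w0 !mulr0 subr0.
  apply/eqP; rewrite -[_ == _]negbK; apply/negP => u_neq0.
  have a0 : a = 0 by apply/eqP; rewrite -(mulIr_eq0 _ (mulIf u_neq0)) au.
  have a'0 : a' = 0 by apply/eqP; rewrite -(mulIr_eq0 _ (mulIf u_neq0)) au'.
  by move: u_neq0; rewrite /u (eq01 _ _ _ _ _ _ Vabc Vabc') ?subrr ?eqxx.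
(* Modulo p all three rows annihilate (L^2, L, 1), so p divides their determinant, which is at most
   54 h^6. *)
have [le_A le_B le_C /dvdzP[Q def_Q]] := V_small _ _ _ VABC.
apply: (@dvdz_small_eq0 p%:Z).
  have def_C : C = Q * p%:Z - A * L ^+ 2 - B * L by rewrite -def_Q; ring.
  apply/dvdzP; exists (A * (b * q' - b' * q) + B * (a' * q - a * q') + Q * w).
  by rewrite /u /v /w def_C def_c def_c'; ring.
apply: le_lt_trans (normD_le (normD_le (normM_le le_u le_A) (normM_le le_v le_B))
  (normM_le le_w le_C)) _.
rewrite (_ : _ + _ = 54 * h ^+ 6); last by rewrite /h; ring.
by apply: le_lt_trans lt_p; rewrite ler_pM ?exprn_ge0 ?pow.
Qed.

(* Both sides are the resultant of [a X^2 - b X + c] with the monic cubic whose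
   roots are the [x_i], resp. the [y_i]; by the three proportionalities these
   two cubics agree modulo the quadratic. *)
Lemma prod_quadratic_eq (a b c x1 x2 x3 y1 y2 y3 : int) :
  let A := x1 + x2 + x3 - (y1 + y2 + y3) in
  let B := x1 * x2 + x1 * x3 + x2 * x3 - (y1 * y2 + y1 * y3 + y2 * y3) in
  let C := x1 * x2 * x3 - y1 * y2 * y3 in
  let q := fun x => a * x ^+ 2 + - b * x + c in
  a * B = A * b -> a * C = A * c -> b * C = B * c ->
  q x1 * q x2 * q x3 = q y1 * q y2 * q y3.
Proof.
move=> A B C q /eqP; rewrite -subr_eq0 => /eqP m1 /eqP; rewrite -subr_eq0 => /eqP m2.
move=> /eqP; rewrite -subr_eq0 => /eqP m3.
apply/eqP; rewrite -subr_eq0; apply/eqP.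
pose e1 := y1 + y2 + y3; pose e2 := y1 * y2 + y1 * y3 + y2 * y3.
pose e3 := y1 * y2 * y3.
transitivity (- b ^+ 2 * (b * C - B * c)
  - (a * C - A * c) * (- 3 * b * c - e1 * (b ^+ 2 - 2 * a * c)
    + e2 * a * b - 2 * e3 * a ^+ 2)
  + (a * B - A * b) * (- 2 * c ^+ 2 - e1 * b * c + 2 * e2 * a * c - e3 * a * b)
  + a * (a * C - A * c) ^+ 2 - (a * B - A * b) * (a * C - A * c) * b
  + (a * B - A * b) ^+ 2 * c); last by rewrite m1 m2 m3; ring.
by rewrite /q /A /B /C /e1 /e2 /e3; ring.
Qed.

Lemma triple_product_equation (p H : nat) (L lam : int) : (144 * H ^ 8 < p)%N ->
  exists a b c n : int, [/\ (a != 0) || (b != 0), (`|n| <= (24 * H ^ 4) ^ 3)%N &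
    forall x1 x2 x3 : int,
      0 <= x1 <= H%:Z -> 0 <= x2 <= H%:Z -> 0 <= x3 <= H%:Z ->
      (p%:Z %| (L + x1) * (L + x2) * (L + x3) - lam)%Z ->
      \prod_(x <- [:: x1; x2; x3]) (a * x ^+ 2 + b * x + c) = n].
Proof.
move=> lt_p; set h := H%:Z.
pose S (x1 x2 x3 : int) := [/\ 0 <= x1 <= h, 0 <= x2 <= h, 0 <= x3 <= h &
  (p%:Z %| (L + x1) * (L + x2) * (L + x3) - lam)%Z].
have [[y1 [y2 [y3 Sy]]]|S0] := pselect (exists y1 y2 y3, S y1 y2 y3); last first.
  exists 0, 1, 0, 0; split=> // x1 x2 x3 h1 h2 h3 dv.
  by case: S0; exists x1, x2, x3.
have h_ge0 : 0 <= h by [].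
have [hy1 hy2 hy3 dvd_y] := Sy.
have norm_h (x : int) : 0 <= x <= h -> `|x| <= h.
  by case/andP=> x_ge0; rewrite ger0_norm.
pose q (a b c x : int) := a * x ^+ 2 + b * x + c.
suff: exists a b c : int, [/\ (a != 0) || (b != 0),
    forall x : int, 0 <= x <= h -> `|q a b c x| <= 24 * h ^+ 4 &
    forall x1 x2 x3 : int, S x1 x2 x3 ->
      q a b c x1 * q a b c x2 * q a b c x3 = q a b c y1 * q a b c y2 * q a b c y3].
  move=> [a [b [c [nz_ab le_q eq_q]]]]; exists a, b, c.
  exists (q a b c y1 * q a b c y2 * q a b c y3).
  split=> // [|x1 x2 x3 h1 h2 h3 dv]; last by rewrite unlock /= mulr1 mulrA eq_q.
  rewrite -lez_nat abszE.
  apply: le_trans (normM_le (normM_le (le_q _ hy1) (le_q _ hy2)) (le_q _ hy3)) _.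
  by rewrite -[leRHS]natz natrX natrM natrX !natz [leRHS]exprSr expr2.
(* Coefficients of f_x - f_y in L, for one fixed solution y: the cubic terms cancel, and so does
   [lam] modulo p. *)
pose V (a b c : int) := exists x1 x2 x3 : int, [/\ S x1 x2 x3,
  a = x1 + x2 + x3 - (y1 + y2 + y3),
  b = x1 * x2 + x1 * x3 + x2 * x3 - (y1 * y2 + y1 * y3 + y2 * y3) &
  c = x1 * x2 * x3 - y1 * y2 * y3].
have in_V x1 x2 x3 : S x1 x2 x3 -> V (x1 + x2 + x3 - (y1 + y2 + y3))
   (x1 * x2 + x1 * x3 + x2 * x3 - (y1 * y2 + y1 * y3 + y2 * y3))
   (x1 * x2 * x3 - y1 * y2 * y3) by exists x1, x2, x3.
have mulh (x x' : int) : 0 <= x <= h -> 0 <= x' <= h -> 0 <= x * x' <= h ^+ 2.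
  by move=> /andP[? ?] /andP[? ?]; rewrite mulr_ge0 //= expr2 ler_pM.
have mulh3 (x x' x'' : int) : 0 <= x <= h -> 0 <= x' <= h -> 0 <= x'' <= h ->
    0 <= x * x' * x'' <= h ^+ 3.
  move=> hx hx' /andP[? ?]; have /andP[? ?] := mulh _ _ hx hx'.
  by rewrite mulr_ge0 //= exprSr ler_pM.
have V_small a b c : V a b c -> [/\ `|a| <= 3 * h, `|b| <= 3 * h ^+ 2, `|c| <= h ^+ 3 &
    (p%:Z %| a * L ^+ 2 + b * L + c)%Z].
  case=> x1 [x2 [x3 [[h1 h2 h3 dv] -> -> ->]]]; split.
  - by move: h1 h2 h3 hy1 hy2 hy3; clear; lia.
  - move: (mulh _ _ h1 h2) (mulh _ _ h1 h3) (mulh _ _ h2 h3).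
    move: (mulh _ _ hy1 hy2) (mulh _ _ hy1 hy3) (mulh _ _ hy2 hy3).
    by clear; lia.
  - move: (mulh3 _ _ _ h1 h2 h3) (mulh3 _ _ _ hy1 hy2 hy3).
    by clear; lia.
  - rewrite (_ : _ + _ = ((L + x1) * (L + x2) * (L + x3) - lam)
              - ((L + y1) * (L + y2) * (L + y3) - lam)); last by ring.
    exact: rpredB.
have pow i : (0 < i <= 4)%N -> h ^+ i <= h ^+ 4 by exact: exp_nat_le.
rewrite /q; case: (small_solutions lt_p V_small) =>
  [zero|[a [b [c [Vabc nz_ab prop]]]]|[u [v [w [w_neq0 le_w le_v v2 orth]]]]].
(* Here x and y have the same elementary symmetric functions, so x is a permutation of y and the
   product of the x_i - y1 is 0. *)
- exists 0, 1, (- y1); split=> // [x hx|x1 x2 x3 Sx].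
    have := pow 1%N isT; rewrite expr1 => le_h.
    by move: hx hy1 le_h; move: (h ^+ 4) => h4; clear; lia.
  have [/eqP + /eqP + /eqP] := zero _ _ _ (in_V _ _ _ Sx).
  rewrite !subr_eq0 => /eqP E1 /eqP E2 /eqP E3.
  transitivity (x1 * x2 * x3 - (x1 * x2 + x1 * x3 + x2 * x3) * y1
    + (x1 + x2 + x3) * y1 ^+ 2 - y1 ^+ 3); first by ring.
  by rewrite E1 E2 E3; ring.
(* The sign of [b] comes from evaluating the quadratic at -x, since the roots of f_x are the
   -x_i. *)
- exists a, (- b), c; split; first by rewrite oppr_eq0.
    move=> x hx; have [le_a le_b le_c _] := V_small _ _ _ Vabc.
    have le_x := norm_h _ hx; rewrite mulNr.
    apply: le_trans (normD_le (normB_le (normM_le le_a (normM_le le_x le_x))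
      (normM_le le_b le_x)) le_c) _.
    rewrite (_ : _ + _ = 7 * h ^+ 3); last by ring.
    by rewrite ler_pM ?exprn_ge0 ?pow.
  by move=> x1 x2 x3 /in_V/prop[E1 E2 E3]; apply: prod_quadratic_eq.
(* Put t = v / w, so u / w = t^2. Orthogonality then says that the product of the t + x_i is the
   same for all solutions; w x + v is w (t + x). Its bound 18 h^4 + 6 h^4 is the 24 h^4 of the
   statement. *)
- exists 0, w, v; split; first by rewrite w_neq0 orbT.
    move=> x hx; rewrite mul0r add0r.
    apply: le_trans (normD_le (normM_le le_w (norm_h _ hx)) le_v) _.
    by rewrite (_ : _ + _ = 24 * h ^+ 4) //; rewrite /h; ring.
  move=> x1 x2 x3 /in_V/orth E; apply/eqP; rewrite -subr_eq0; apply/eqP.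
  transitivity (w ^+ 2 * (w * (x1 * x2 * x3 - y1 * y2 * y3) +
     v * (x1 * x2 + x1 * x3 + x2 * x3 - (y1 * y2 + y1 * y3 + y2 * y3)))
    + w * v ^+ 2 * (x1 + x2 + x3 - (y1 + y2 + y3))); first by ring.
  by rewrite v2 -[RHS](mulr0 (w ^+ 2)) -E; ring.
Qed.

(** The differences A L + B are now linear in L, and one 2x2 minor, at most 4 h^3, eliminates L. The
    quadratic shape and the bound on [n] match the triple case, so that one divisor bound serves
    both. *)
Lemma pair_product_equation (p H : nat) (L lam : int) : (144 * H ^ 8 < p)%N ->
  exists a b c n : int, [/\ (a != 0) || (b != 0), (`|n| <= (24 * H ^ 4) ^ 3)%N &
    forall x1 x2 : int, 0 <= x1 <= H%:Z -> 0 <= x2 <= H%:Z ->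
      (p%:Z %| (L + x1) * (L + x2) - lam)%Z ->
      \prod_(x <- [:: x1; x2]) (a * x ^+ 2 + b * x + c) = n].
Proof.
move=> lt_p8; set h := H%:Z.
have {lt_p8} lt_p : 144 * h ^+ 8 < p%:Z by rewrite /h; lia.
have h_ge0 : 0 <= h by [].
have lt_p3 : 4 * h ^+ 3 < p%:Z.
  by apply: le_lt_trans lt_p; rewrite ler_pM ?exprn_ge0 ?exp_nat_le.
pose S (x1 x2 : int) := [/\ 0 <= x1 <= h, 0 <= x2 <= h &
  (p%:Z %| (L + x1) * (L + x2) - lam)%Z].
have [[y1 [y2 Sy]]|S0] := pselect (exists y1 y2, S y1 y2); last first.
  exists 0, 1, 0, 0; split=> // x1 x2 h1 h2 dv.
  by case: S0; exists x1, x2.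
have [hy1 hy2 dvd_y] := Sy.
have norm_h (x : int) : 0 <= x <= h -> `|x| <= h.
  by case/andP=> x_ge0; rewrite ger0_norm.
suff: exists b c : int, [/\ b != 0,
    forall x : int, 0 <= x <= h -> `|b * x + c| <= 3 * h ^+ 2 &
    forall x1 x2 : int, S x1 x2 ->
      (b * x1 + c) * (b * x2 + c) = (b * y1 + c) * (b * y2 + c)].
  move=> [b [c [b_neq0 le_q eq_q]]]; exists 0, b, c, ((b * y1 + c) * (b * y2 + c)).
  split=> [||x1 x2 h1 h2 dv]; first by rewrite b_neq0 orbT.
    rewrite -lez_nat abszE; apply: le_trans (normM_le (le_q _ hy1) (le_q _ hy2)) _.
    rewrite -[leRHS]natz natrX natrM natrX !natz.
    rewrite (_ : _ * _ = 9 * h ^+ 4); last by ring.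
    by rewrite exprMn -exprM ler_pM ?exprn_ge0 ?exp_nat_le.
  by rewrite unlock /= mulr1 !mul0r !add0r eq_q.
pose A (x1 x2 : int) := x1 + x2 - (y1 + y2).
pose B (x1 x2 : int) := x1 * x2 - y1 * y2.
have mulh (x x' : int) : 0 <= x <= h -> 0 <= x' <= h -> 0 <= x * x' <= h ^+ 2.
  by move=> /andP[? ?] /andP[? ?]; rewrite mulr_ge0 //= expr2 ler_pM.
have AB_small x1 x2 : S x1 x2 -> [/\ `|A x1 x2| <= 2 * h, `|B x1 x2| <= h ^+ 2 &
    (p%:Z %| A x1 x2 * L + B x1 x2)%Z].
  case=> h1 h2 dv; split.
  - by rewrite /A; move: h1 h2 hy1 hy2; clear; lia.
  - by rewrite /B; move: (mulh _ _ h1 h2) (mulh _ _ hy1 hy2); clear; lia.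
  - rewrite (_ : _ + _ = ((L + x1) * (L + x2) - lam) - ((L + y1) * (L + y2) - lam)).
      exact: rpredB.
    by rewrite /A /B; ring.
have pow3 i : (0 < i <= 3)%N -> h ^+ i <= h ^+ 3 by exact: exp_nat_le.
have [A0|] := pselect (forall x1 x2, S x1 x2 -> A x1 x2 = 0).
  exists 1, (- y1); split=> // [x hx|x1 x2 Sx].
    have := exp_nat_le H (isT : 0 < 1 <= 2)%N; rewrite expr1 -/h => le_h.
    by move: hx hy1 le_h; move: (h ^+ 2) => h2; clear; lia.
  have [_ le_B] := AB_small _ _ Sx; have := A0 _ _ Sx => Ax0.
  rewrite Ax0 mul0r add0r => /dvdz_small_eq0 Bx0.
  have {}Bx0 : B x1 x2 = 0.
    apply: Bx0; apply: le_lt_trans le_B _; apply: le_lt_trans lt_p3.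
    by rewrite -[leLHS]mul1r ler_pM ?exprn_ge0 ?pow3.
  transitivity (B x1 x2 - y1 * A x1 x2 + (1 * y1 - y1) * (1 * y2 - y1)).
    by rewrite /A /B; ring.
  by rewrite Ax0 Bx0 mulr0 subr0 add0r.
move=> nA; have [z1 [z2 [Sz A_neq0]]] : exists z1 z2, S z1 z2 /\ A z1 z2 != 0.
  apply: contrapT => no; apply: nA => x1 x2 Sx; apply: contrapT => /eqP ?.
  by apply: no; exists x1, x2.
have [le_a le_b /dvdzP[q def_q]] := AB_small _ _ Sz.
(* As A L + B is 0 modulo p, A x - B stands for A (L + x). *)
exists (A z1 z2), (- B z1 z2); split=> // [x hx|x1 x2 Sx].
  apply: le_trans (normB_le (normM_le le_a (norm_h _ hx)) le_b) _.
  by rewrite (_ : _ + _ = 3 * h ^+ 2) //; ring.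
have [le_a' le_b' /dvdzP[q' def_q']] := AB_small _ _ Sx.
have minor : A z1 z2 * B x1 x2 - A x1 x2 * B z1 z2 = 0.
  apply: (@dvdz_small_eq0 p%:Z).
    apply/dvdzP; exists (A z1 z2 * q' - A x1 x2 * q).
    by rewrite [RHS]mulrBl -[in RHS]mulrA -def_q' -[in RHS]mulrA -def_q; ring.
  apply: le_lt_trans (normB_le (normM_le le_a le_b') (normM_le le_a' le_b)) _.
  by rewrite (_ : _ + _ = 4 * h ^+ 3) //; ring.
apply/eqP; rewrite -subr_eq0; apply/eqP.
transitivity (A z1 z2 * (A z1 z2 * B x1 x2 - A x1 x2 * B z1 z2)); last first.
  by rewrite minor mulr0.
by rewrite [A x1 x2]/A [B x1 x2]/B; ring.
Qed.

(** * Counting representations *)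

Lemma sum_mem_le (I : finType) (s : {set I}) (F : I -> nat) (K B : nat) :
  (#|s| <= K)%N -> (forall x, (F x <= B)%N) ->
  (\sum_x (x \in s) * F x <= K * B)%N.
Proof.
move=> size_s le_B; apply: (@leq_trans (#|s| * B)); last by rewrite leq_mul2r size_s orbT.
rewrite -sum_nat_const [leqRHS]big_mkcond; apply: leq_sum => x _.
by case: (x \in s); rewrite ?mul1n.
Qed.

Lemma sum_eq_mul_le1 (I : finType) (F : fieldType) (r : I -> F) (a b : F) :
  injective r -> a != 0 -> (\sum_x (a * r x == b)%R <= 1)%N.
Proof.
move=> r_inj a_neq0; have [[x0 def_b]|no] := pselect (exists x, a * r x = b).
  rewrite (bigD1 x0) //= def_b eqxx big1 // => x x_x0; apply/eqP.
  by rewrite eqb0 -def_b (inj_eq (mulfI a_neq0)) (inj_eq r_inj).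
by rewrite big1 // => x _; apply/eqP; rewrite eqb0; apply/eqP => ?; apply: no; exists x.
Qed.

Section Representations.
Variables (I : finType) (F : fieldType) (r : I -> F) (K : nat).
Hypotheses (r_inj : injective r) (r_neq0 : forall x, r x != 0).

(** One of the two coordinates lies in a set of at most K elements and determines the other. *)
Lemma pair_representations :
  (forall b, exists2 s : {set I}, (#|s| <= K)%N &
     forall x y, r x * r y = b -> (x \in s) || (y \in s)) ->
  forall b, (\sum_x \sum_y (r x * r y == b)%R <= 2 * K)%N.
Proof.
move=> cover b; have [s size_s mem_s] := cover b.
apply: (@leq_trans (\sum_x (x \in s) * (\sum_y (r x * r y == b)%R)
                  + \sum_y (y \in s) * (\sum_x (r y * r x == b)%R))).
  under [X in (_ <= X + _)%N]eq_bigr => x _ do rewrite big_distrr.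
  under [X in (_ <= _ + X)%N]eq_bigr => x _ do rewrite big_distrr.
  rewrite [X in (_ <= _ + X)%N]exchange_big -big_split; apply: leq_sum => x _.
  rewrite -big_split; apply: leq_sum => y _ /=; rewrite (mulrC (r y)).
  by case: eqP => // /mem_s /orP[] ->; rewrite ?leq_addl ?leq_addr.
rewrite mul2n -addnn -[K in (_ <= K + K)%N]muln1.
by apply: leq_add; apply: sum_mem_le => // x; apply: sum_eq_mul_le1.
Qed.

(** Three positions for the coordinate in [s], K values for it, and at most 2 K pairs for the other
    two, whose product is then fixed. *)
Lemma triple_representations :
  (forall b, exists2 s : {set I}, (#|s| <= K)%N &
     forall x y, r x * r y = b -> (x \in s) || (y \in s)) ->
  (forall b, exists2 s : {set I}, (#|s| <= K)%N &
     forall x y z, r x * r y * r z = b -> [|| x \in s, y \in s | z \in s]) ->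
  forall b, (\sum_x \sum_y \sum_z (r x * r y * r z == b)%R <= 6 * K ^ 2)%N.
Proof.
move=> cover2 cover3 b; have [s size_s mem_s] := cover3 b.
pose P x := (\sum_y \sum_z (r x * r y * r z == b)%R)%N.
have le_P x : (P x <= 2 * K)%N.
  apply: leq_trans (pair_representations cover2 (b / r x)).
  apply: leq_sum => y _; apply: leq_sum => z _.
  rewrite -(inj_eq (mulfI (r_neq0 x)) (r y * r z)) [_ * (b / _)]mulrCA.
  by rewrite divff // mulr1 mulrA.
apply: (@leq_trans (\sum_x (x \in s) * P x + \sum_y (y \in s) * P y
                  + \sum_z (z \in s) * P z)); last first.
  have -> : (6 * K ^ 2 = K * (2 * K) + K * (2 * K) + K * (2 * K))%N by lia.
  by rewrite !leq_add // sum_mem_le.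
have E1 : (\sum_x (x \in s) * P x
    = \sum_x \sum_y \sum_z (x \in s) * (r x * r y * r z == b)%R)%N.
  by apply: eq_bigr => x _; rewrite big_distrr; apply: eq_bigr => y _; rewrite big_distrr.
have E2 : (\sum_x (x \in s) * P x
    = \sum_x \sum_y \sum_z (y \in s) * (r x * r y * r z == b)%R)%N.
  rewrite E1 exchange_big; apply: eq_bigr => x _; apply: eq_bigr => y _.
  by apply: eq_bigr => z _; rewrite (mulrC (r y)).
have E3 : (\sum_x (x \in s) * P x
    = \sum_x \sum_y \sum_z (z \in s) * (r x * r y * r z == b)%R)%N.
  rewrite E2; apply: eq_bigr => x _; rewrite exchange_big; apply: eq_bigr => y _.
  by apply: eq_bigr => z _; rewrite mulrAC.
rewrite {1}E1 {1}E2 E3 -!big_split; apply: leq_sum => x _.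
rewrite -!big_split; apply: leq_sum => y _; rewrite -!big_split; apply: leq_sum => z _ /=.
by case: eqP => // /mem_s /or3P[] ->; lia.
Qed.
End Representations.

Lemma card_ord_in_seq (m : nat) (s : seq int) :
  (#|[set i : 'I_m | i%:Z \in s]| <= size s)%N.
Proof.
rewrite cardE -(size_map (fun i : 'I_m => i%:Z)); apply: uniq_leq_size.
  by rewrite map_inj_uniq ?enum_uniq // => i j [] /val_inj.
by move=> x /mapP[i]; rewrite mem_enum inE => i_s ->.
Qed.

(** * Representations by residues of a short interval *)

Section Residues.
Variables (p H : nat) (L : int).
Hypotheses (p_pr : prime p) (lt_p : (144 * H ^ 8 < p)%N).
Let r (i : 'I_H.+1) : 'F_p := (L + i%:Z)%:~R.

Lemma residues_inj : injective r.
Proof.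
move=> i j /eqP; rewrite /r -subr_eq0 -rmorphB /= -(dvdz_pcharf (pchar_Fp p_pr)).
move=> /dvdz_small_eq0; rewrite opprD addrACA subrr add0r => eq_ij.
apply/val_inj; suff : i%:Z - j%:Z = 0 by move/eqP; rewrite subr_eq0 => /eqP[].
apply: eq_ij; have := ltn_ord i; have := ltn_ord j.
have : (H <= H ^ 8)%N by rewrite -[leqLHS]expn1; case: (H) => // h; rewrite leq_pexp2l.
by move: lt_p; move: (H ^ 8)%N => H8; lia.
Qed.

Variable K : nat.
Hypothesis le_K :
  forall n, (n <= (24 * H ^ 4) ^ 3)%N -> (4 * size (divisors n) + 2 <= K)%N.

Fact ord_int_bounds (i : 'I_H.+1) : 0 <= i%:Z <= H%:Z.
Proof. by rewrite lez_nat /= -ltnS ltn_ord. Qed.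

Lemma residues_pair_cover (b : 'F_p) : exists2 s : {set 'I_H.+1}, (#|s| <= K)%N &
  forall x y, r x * r y = b -> (x \in s) || (y \in s).
Proof.
have [A [B [C [n [nz_AB le_n eq_n]]]]] := pair_product_equation L (b : nat)%:Z lt_p.
have [s [size_s mem_s]] := quadratic_prod_eq C n nz_AB.
exists [set i : 'I_H.+1 | i%:Z \in s].
  by apply: leq_trans (card_ord_in_seq _ _) (leq_trans size_s (le_K le_n)).
move=> x y def_b; have := mem_s [:: x%:Z; y%:Z] isT; rewrite /= orbF !inE; apply.
apply: eq_n; [exact: ord_int_bounds | exact: ord_int_bounds | ].
rewrite (dvdz_pcharf (pchar_Fp p_pr)) rmorphB rmorphM /= -/(r x) -/(r y) def_b.
by rewrite -pmulrn natr_Zp subrr.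
Qed.

Lemma residues_triple_cover (b : 'F_p) : exists2 s : {set 'I_H.+1}, (#|s| <= K)%N &
  forall x y z, r x * r y * r z = b -> [|| x \in s, y \in s | z \in s].
Proof.
have [A [B [C [n [nz_AB le_n eq_n]]]]] := triple_product_equation L (b : nat)%:Z lt_p.
have [s [size_s mem_s]] := quadratic_prod_eq C n nz_AB.
exists [set i : 'I_H.+1 | i%:Z \in s].
  by apply: leq_trans (card_ord_in_seq _ _) (leq_trans size_s (le_K le_n)).
move=> x y z def_b; have := mem_s [:: x%:Z; y%:Z; z%:Z] isT; rewrite /= orbF !inE; apply.
apply: eq_n; [exact: ord_int_bounds.. | ].
rewrite (dvdz_pcharf (pchar_Fp p_pr)) rmorphB !rmorphM /= -/(r x) -/(r y) -/(r z) def_b.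
by rewrite -pmulrn natr_Zp subrr.
Qed.
End Residues.

Lemma interval_triple_representations (j : nat) : (0 < j)%N ->
  exists2 C : nat, (0 < C)%N & forall (p H : nat) (L : int),
    prime p -> (144 * H ^ 8 < p)%N ->
    let r (i : 'I_H.+1) : 'F_p := (L + i%:Z)%:~R in
    (forall i, r i != 0) ->
    exists2 B : nat, (B ^ j <= C * H.+1)%N &
      forall b, (\sum_x \sum_y \sum_z (r x * r y * r z == b)%R <= B)%N.
Proof.
(* The bound B will be quadratic in the number of divisors t of some n <= 13824 H^12. The divisor
   bound with exponent 2 * 12 * j thus controls B^(12 j) by H^12. *)
move=> j_gt0; have k_gt0 : (0 < 24 * j)%N by rewrite muln_gt0.
have [C1 le_C1] := size_divisors_bound k_gt0.
have C1_gt0 : (0 < C1)%N by have := le_C1 1%N isT; rewrite muln1 exp1n.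
set C := (216 ^ (12 * j) * (C1 * 13824))%N.
have C_gt0 : (0 < C)%N by rewrite !muln_gt0 expn_gt0 C1_gt0.
exists C => // p H L p_pr lt_p r r_neq0.
set N := ((24 * H ^ 4) ^ 3)%N.
pose K := (\max_(n < N.+1) (4 * size (divisors n) + 2))%N.
have le_K n : (n <= N)%N -> (4 * size (divisors n) + 2 <= K)%N.
  by rewrite -ltnS => lt_n; apply: (bigop.leq_bigmax (Ordinal lt_n)).
have := triple_representations (residues_inj p_pr lt_p) r_neq0
  (residues_pair_cover L p_pr lt_p le_K) (residues_triple_cover L p_pr lt_p le_K).
move=> le_T.
have [n0 def_K] : {n0 : 'I_N.+1 | K = (4 * size (divisors n0) + 2)%N}.
  by apply: bigop.eq_bigmax; rewrite card_ord.
set t := size (divisors n0) in def_K.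
have t_gt0 : (0 < t)%N by rewrite /t; case: (divisors n0) (divisor1 n0).
(* As t >= 1, K = 4 t + 2 <= 6 t, and 6 (6 t)^2 = 216 t^2. *)
exists (216 * t ^ 2)%N; last first.
  move=> b; apply: leq_trans (le_T b) _.
  have -> : (216 * t ^ 2 = 6 * (6 * t) ^ 2)%N by lia.
  by rewrite leq_mul2l leq_exp2r // def_K; lia.
rewrite -(leq_exp2r _ _ (isT : 0 < 12)%N) -expnM [(j * 12)%N]mulnC expnMn -expnM mulnA.
have le_t : (t ^ (2 * 12 * j) <= C1 * 13824 * H.+1 ^ 12)%N.
  have [n0_0|n0_gt0] := posnP n0.
    by rewrite /t n0_0 exp1n !muln_gt0 C1_gt0 /=.
  apply: leq_trans (le_C1 _ n0_gt0) _; rewrite -mulnA leq_mul2l; apply/orP; right.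
  have := ltn_ord n0; rewrite ltnS /N => /leq_trans; apply.
  by rewrite expnMn -expnM leq_mul // leq_exp2r.
rewrite expnMn; apply: (@leq_trans (C * H.+1 ^ 12)).
  by rewrite /C -[leqRHS]mulnA leq_mul2l le_t orbT.
by rewrite leq_mul2r -[leqLHS]expn1 leq_pexp2l ?orbT.
Qed.

(** * Multiplicative energy *)

(** Twice both sides are double sums, compared termwise by 2 m n <= m^2 + n^2 with m = a_i b_j and n
    = b_i a_j. *)
Lemma sum_nat_CauchySchwarz (V : finType) (a b : V -> nat) :
  ((\sum_v a v * b v) ^ 2 <= (\sum_v a v ^ 2) * (\sum_v b v ^ 2))%N.
Proof.
rewrite -(leq_pmul2l (isT : 0 < 2)%N) -mulnn [leqRHS]mul2n -addnn.
rewrite [X in (_ <= _ + X)%N]mulnC !big_distrlr big_distrr -big_split.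
apply: leq_sum => i _; rewrite /= big_distrr -big_split; apply: leq_sum => j _ /=.
have := nat_Cauchy (a i * b j) (b i * a j) => -[+ _].
by rewrite !expnMn; lia.
Qed.

(** For [f = g] this is the second moment of the fibre sizes of [f], an energy. *)
Definition coincidences (T T' : finType) (V : eqType)
    (f : T -> V) (g : T' -> V) : nat :=
  \sum_(q : T * T') (f q.1 == g q.2).

Section Coincidences.
Variable V : finType.

Lemma coincidencesE (T T' : finType) (f : T -> V) (g : T' -> V) :
  coincidences f g = (\sum_v (\sum_t (f t == v)) * (\sum_t (g t == v)))%N.
Proof.
under eq_bigr => v _ do rewrite big_distrlr pair_bigA /=.
rewrite exchange_big; apply: eq_bigr => -[t t'] _ /=.
rewrite (bigD1 (g t')) //= eqxx muln1 big1 ?addn0 // => v /negPf v_g.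
by rewrite (eq_sym (g t')) v_g muln0.
Qed.

Lemma coincidences_CauchySchwarz (T T' : finType) (f : T -> V) (g : T' -> V) :
  (coincidences f g ^ 2 <= coincidences f f * coincidences g g)%N.
Proof.
rewrite !coincidencesE; apply: leq_trans (sum_nat_CauchySchwarz _ _) _.
by under eq_bigr do rewrite -mulnn; under [X in (_ * X)%N]eq_bigr do rewrite -mulnn.
Qed.

(** Cauchy-Schwarz for the fibre sizes of [f] against the indicator of [P]. *)
Lemma card_sqr_le_coincidences (T : finType) (f : T -> V) (P : {set V}) :
  (forall t, f t \in P) -> (#|T| ^ 2 <= #|P| * coincidences f f)%N.
Proof.
move=> f_P; have -> : #|T| = (\sum_v (v \in P) * (\sum_t (f t == v)))%N.
  under eq_bigr => v _ do rewrite big_distrr /=.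
  rewrite exchange_big -sum1_card; apply: eq_bigr => t _ /=.
  rewrite (bigD1 (f t)) //= f_P eqxx big1 // => v /negPf v_f.
  by rewrite eq_sym v_f muln0.
apply: leq_trans (sum_nat_CauchySchwarz _ _) _; rewrite coincidencesE.
under [X in (_ * X <= _)%N]eq_bigr do rewrite -mulnn.
rewrite leq_mul2r -sum1_card [leqRHS]big_mkcond; apply/orP; right.
by apply: leq_sum => v _; case: (v \in P).
Qed.
End Coincidences.

Section Energy.
Variable F : finFieldType.

Definition energy3 (I J K : finType) (u : I -> F) (v : J -> F) (w : K -> F) : nat :=
  let f := fun t : I * J * K => u t.1.1 * v t.1.2 * w t.2 in coincidences f f.

Lemma energy3_swap (I J K : finType) (u : I -> F) (v : J -> F) (w : K -> F) :
  energy3 u v w = energy3 u w v.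
Proof.
pose h (A B C : Type) (t : A * B * C) := (t.1.1, t.2, t.1.2).
pose hh (A B C : Type) (q : (A * B * C) * (A * B * C)) := (h _ _ _ q.1, h _ _ _ q.2).
rewrite /energy3 /coincidences (reindex (@hh I K J)) /=; last first.
  by exists (@hh I J K) => [[[[x y] z] [[x' y'] z']]|[[[x y] z] [[x' y'] z']]].
by apply: eq_bigr => -[[[x y] z] [[x' y'] z']] _ /=; rewrite mulrAC [X in _ == X]mulrAC.
Qed.

Section Ratios.
Variables (I J K : finType) (u : I -> F) (v : J -> F) (w : K -> F).
Hypotheses (u_neq0 : forall x, u x != 0) (v_neq0 : forall x, v x != 0).

(* [u x v y w z = u x' v y' w z'] is separated into
   [(u x / u x') w z = (v y' / v y) w z']. *)
Lemma energy3E : energy3 u v w =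
  coincidences (fun t : I * I * K => u t.1.1 / u t.1.2 * w t.2)
               (fun t : J * J * K => v t.1.1 / v t.1.2 * w t.2).
Proof.
rewrite /energy3 /coincidences.
pose h (q : (I * I * K) * (J * J * K)) : (I * J * K) * (I * J * K) :=
  ((q.1.1.1, q.2.1.2, q.1.2), (q.1.1.2, q.2.1.1, q.2.2)).
pose h' (q : (I * J * K) * (I * J * K)) : (I * I * K) * (J * J * K) :=
  ((q.1.1.1, q.2.1.1, q.1.2), (q.2.1.2, q.1.1.2, q.2.2)).
rewrite (reindex h) /=; last first.
  by exists h' => [[[[x y] z] [[x' y'] z']]|[[[x y] z] [[x' y'] z']]].
apply: eq_bigr => -[[[x x'] z] [[y' y] z']] _ /=; congr (nat_of_bool _).
have n0 : u x' * v y != 0 by rewrite mulf_neq0.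
rewrite -(inj_eq (mulfI n0) (u x / u x' * w z)).
have -> : u x' * v y * (u x / u x' * w z) = u x * v y * w z by field.
by have -> : u x' * v y * (v y' / v y * w z') = u x' * v y' * w z' by field.
Qed.
End Ratios.

(** After the separation into ratios, the self-coincidences of the two sides are again energies. *)
Lemma energy3_CauchySchwarz (I J K : finType) (u : I -> F) (v : J -> F) (w : K -> F) :
  (forall x, u x != 0) -> (forall x, v x != 0) ->
  (energy3 u v w ^ 2 <= energy3 u u w * energy3 v v w)%N.
Proof. by move=> *; rewrite !energy3E //; apply: coincidences_CauchySchwarz. Qed.

(** With a = E(u,u,w) and b = E(w,w,u), Cauchy-Schwarz gives a^2 <= E(u,u,u) b and b^2 <= E(w,w,w)
    a; eliminate b and cancel a. *)
Lemma energy3_uuw (I K : finType) (u : I -> F) (w : K -> F) :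
  (forall x, u x != 0) -> (forall x, w x != 0) ->
  (energy3 u u w ^ 3 <= energy3 u u u ^ 2 * energy3 w w w)%N.
Proof.
move=> u0 w0; have := energy3_CauchySchwarz u u0 w0; have := energy3_CauchySchwarz w w0 u0.
rewrite (energy3_swap w u w) (energy3_swap u w u).
set a := energy3 u u w; set b := energy3 w w u.
set nu := energy3 u u u; set nw := energy3 w w w.
move=> le_b le_a; have [->|a_gt0] := posnP a; first by rewrite exp0n.
rewrite -(leq_pmul2r a_gt0) -expnSr (expnM a 2 2).
apply: (@leq_trans ((nu * b) ^ 2)); first by rewrite leq_exp2r.
by rewrite expnMn -mulnA leq_mul2l le_b orbT.
Qed.

(** The sixth power of the mixed energy is at most E(u,u,w)^3 E(v,v,w)^3, hence at most the square
    of the right-hand side. *)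
Lemma energy3_Hoelder (I J K : finType) (u : I -> F) (v : J -> F) (w : K -> F) :
  (forall x, u x != 0) -> (forall x, v x != 0) -> (forall x, w x != 0) ->
  (energy3 u v w ^ 3 <= energy3 u u u * energy3 v v v * energy3 w w w)%N.
Proof.
move=> u0 v0 w0; rewrite -(leq_exp2r _ _ (isT : 0 < 2)%N) expnAC.
apply: (@leq_trans ((energy3 u u w * energy3 v v w) ^ 3)).
  by rewrite leq_exp2r // energy3_CauchySchwarz.
rewrite expnMn; apply: leq_trans (leq_mul (energy3_uuw u0 w0) (energy3_uuw v0 w0)) _.
by rewrite !expnMn mulnACA -mulnn.
Qed.

(** Each of the |I|^3 left-hand triples fixes the product, which leaves at most B right-hand
    ones. *)
Lemma energy3_diag_le (I : finType) (u : I -> F) (B : nat) :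
  (forall b, \sum_x \sum_y \sum_z (u x * u y * u z == b)%R <= B)%N ->
  (energy3 u u u <= #|I| ^ 3 * B)%N.
Proof.
move=> le_B; rewrite /energy3 /coincidences.
rewrite -(pair_bigA _ (fun t t' : I * I * I =>
  (u t.1.1 * u t.1.2 * u t.2 == u t'.1.1 * u t'.1.2 * u t'.2) : nat)) /=.
apply: (@leq_trans (\sum_(t : I * I * I) B)); last first.
  by rewrite sum_nat_const !card_prod !expnS muln1 mulnA.
apply: leq_sum => t _; set b := u t.1.1 * _ * _.
rewrite -(pair_bigA _ (fun s z => (b == u s.1 * u s.2 * u z) : nat)) /=.
rewrite -(pair_bigA _ (fun x y => (\sum_z (b == (u x * u y * u z)%R))%N)) /=.
apply: leq_trans (le_B b); do 3!apply: leq_sum => ? _; by rewrite eq_sym.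
Qed.
End Energy.

(** * Product sets *)

Lemma card_consecutive_residues (p : nat) (L : int) (N : nat) :
  prime p -> (N < p)%N -> #|consecutive_residues p L N| = N.
Proof.
move=> p_pr lt_N; rewrite /consecutive_residues card_imset ?card_ord // => i j /eqP.
rewrite -subr_eq0 -rmorphB /= -(dvdz_pcharf (pchar_Fp p_pr)) => /dvdz_small_eq0.
rewrite opprD addrACA subrr add0r => eq_ij; apply/val_inj.
suff : i.+1%:Z - j.+1%:Z = 0 by move/eqP; rewrite subr_eq0 => /eqP[].
by apply: eq_ij; have := ltn_ord i; have := ltn_ord j; lia.
Qed.

(** Keep the first H + 1 of the N residues, H being half of N - 1 rounded down: then 144 H^8 <= (2
    H)^8 <= N^8 < p. *)
Lemma interval_half (p : nat) (I : {set 'F_p}) : prime p ->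
  is_Fp_interval p I -> (#|I| ^ 8 < p)%N ->
  exists (H : nat) (L : int), let r (i : 'I_H.+1) : 'F_p := (L + i%:Z)%:~R in
    [/\ (144 * H ^ 8 < p)%N, (0 < #|I| <= 2 * H.+1)%N, forall i, r i != 0 &
        forall i, r i \in I].
Proof.
move=> p_pr [L [N [/andP[N_gt0 lt_N] nz_I def_I]]].
have card_I : #|I| = N by rewrite def_I card_consecutive_residues.
rewrite card_I => lt_N8; exists N.-1./2, (L + 1) => r.
have lt_ord (i : 'I_(N.-1./2).+1) : (i < N)%N.
  by have := ltn_ord i; rewrite ltnS; lia.
have r_E (i : 'I_(N.-1./2).+1) : r i = (L + (Ordinal (lt_ord i)).+1%:Z)%:~R.
  by rewrite /r -addrA.
split=> [|||i]; last by rewrite def_I r_E; apply/imsetP; exists (Ordinal (lt_ord i)).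
- apply: leq_ltn_trans lt_N8; apply: (@leq_trans ((2 * N.-1./2) ^ 8)).
    by rewrite expnMn leq_mul2r orbT.
  by rewrite leq_exp2r //; lia.
- by rewrite N_gt0 /=; lia.
- by move=> i; rewrite r_E -(dvdz_pcharf (pchar_Fp p_pr)).
Qed.

Lemma prodset3_card_le (p : nat) (A B C : {set 'F_p}) :
  (#|prodset3 p A B C| <= #|A| * #|B| * #|C|)%N.
Proof.
rewrite -!cardsX; set P := finset.setX _ C.
apply: leq_trans (leq_imset_card (fun t => t.1.1 * t.1.2 * t.2) P).
apply: subset_leq_card.
apply/fintype.subsetP => t; rewrite inE => /existsP[x /andP[xA]].
move=> /existsP[y /andP[yB /existsP[z /andP[zC /eqP->]]]].
by apply/imsetP; exists (x, y, z); rewrite ?inE /= ?xA ?yB.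
Qed.

Lemma prodset3_card_ge (j : nat) : (0 < j)%N ->
  exists2 Q : nat, (0 < Q)%N & forall p : nat, prime p ->
    forall I1 I2 I3 : {set 'F_p},
      is_Fp_interval p I1 -> is_Fp_interval p I2 -> is_Fp_interval p I3 ->
      (#|I1| ^ 8 < p)%N -> (#|I2| ^ 8 < p)%N -> (#|I3| ^ 8 < p)%N ->
      (0 < #|I1| * #|I2| * #|I3|)%N /\
      ((#|I1| * #|I2| * #|I3|) ^ (3 * j).-1
        <= (Q * #|prodset3 p I1 I2 I3|) ^ (3 * j))%N.
Proof.
move=> j_gt0; have [C C_gt0 le_C] := interval_triple_representations j_gt0.
(* The 8 pays for halving three intervals, C^3 for their three representation bounds. *)
exists (8 * C ^ 3)%N => [|p p_pr I1 I2 I3 int1 int2 int3 lt1 lt2 lt3].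
  by rewrite muln_gt0 expn_gt0 C_gt0.
have [H1 [L1 [lt_p1 /andP[gt1 le1] nz1 in1]]] := interval_half p_pr int1 lt1.
have [H2 [L2 [lt_p2 /andP[gt2 le2] nz2 in2]]] := interval_half p_pr int2 lt2.
have [H3 [L3 [lt_p3 /andP[gt3 le3] nz3 in3]]] := interval_half p_pr int3 lt3.
split; first by rewrite !muln_gt0 gt1 gt2 gt3.
have [B1 le_B1 /energy3_diag_le E1] := le_C _ _ _ p_pr lt_p1 nz1.
have [B2 le_B2 /energy3_diag_le E2] := le_C _ _ _ p_pr lt_p2 nz2.
have [B3 le_B3 /energy3_diag_le E3] := le_C _ _ _ p_pr lt_p3 nz3.
have E123 := leq_trans (energy3_Hoelder nz1 nz2 nz3) (leq_mul (leq_mul E1 E2) E3).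
rewrite !card_ord in E123; set n := (H1.+1 * H2.+1 * H3.+1)%N.
set P := #|prodset3 _ _ _ _|; set N := (#|I1| * _ * _)%N.
have le_N : (N <= 8 * n)%N.
  apply: leq_trans (leq_mul (leq_mul le1 le2) le3) _.
  by rewrite /n; lia.
have n_gt0 : (0 < n)%N by rewrite !muln_gt0.
have le_n2 : (n ^ 2 <= P * energy3 (fun i : 'I_H1.+1 => (L1 + i%:Z)%:~R : 'F_p)
    (fun i : 'I_H2.+1 => (L2 + i%:Z)%:~R) (fun i : 'I_H3.+1 => (L3 + i%:Z)%:~R))%N.
  have -> : n = #|{: 'I_H1.+1 * 'I_H2.+1 * 'I_H3.+1}| by rewrite !card_prod !card_ord.
  apply: card_sqr_le_coincidences => -[[x y] z]; rewrite inE /=.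
  apply/existsP; exists (L1 + x%:Z)%:~R; rewrite in1; apply/existsP.
  exists (L2 + y%:Z)%:~R; rewrite in2; apply/existsP.
  by exists (L3 + z%:Z)%:~R; rewrite in3 /=.
(* Cube n^2 <= P E, insert E^3 <= n^3 B1 B2 B3 and cancel n^3. The j-th power then turns B1 B2 B3
   into C^3 n. *)
have {E123} le_n3 : (n ^ 3 <= P ^ 3 * (B1 * B2 * B3))%N.
  have n3_gt0 : (0 < n ^ 3)%N by rewrite expn_gt0 n_gt0.
  rewrite -(leq_pmul2r n3_gt0) -expnD (expnM n 2 3).
  apply: (@leq_trans ((P * _) ^ 3)); first by rewrite leq_exp2r //; exact: le_n2.
  rewrite expnMn -mulnA leq_mul2l; apply/orP; right.
  by apply: leq_trans E123 _; rewrite /n !expnMn; lia.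
have {le_n3} le_n3j : (n ^ (3 * j).-1 <= P ^ (3 * j) * C ^ 3)%N.
  rewrite -(leq_pmul2r n_gt0) -expnSr prednK ?muln_gt0 // expnM.
  apply: (@leq_trans ((P ^ 3 * (B1 * B2 * B3)) ^ j)); first by rewrite leq_exp2r.
  rewrite expnMn -expnM -[leqRHS]mulnA leq_mul2l; apply/orP; right.
  rewrite !expnMn; apply: leq_trans (leq_mul (leq_mul le_B1 le_B2) le_B3) _.
  by rewrite /n; lia.
apply: (@leq_trans ((8 * n) ^ (3 * j).-1)).
  by case: (3 * j)%N (le_n3j) => [|[|k]] // _; rewrite leq_exp2r.
rewrite [leqLHS]expnMn [leqRHS]expnMn expnMn -[leqRHS]mulnA; apply: leq_mul.
  by rewrite leq_pexp2l // leq_pred.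
apply: leq_trans le_n3j _; rewrite mulnC leq_mul2r -[leqLHS]expn1 leq_pexp2l ?orbT //.
  by rewrite expn_gt0 C_gt0.
by rewrite muln_gt0.
Qed.

(** * The bounds with real exponents *)

Theorem corollary2 (R : realType) (eps : R) (heps : 0 < eps) :
  exists (p0 : nat) (c : R), 0 < c /\
    forall p : nat, prime p -> (p0 <= p)%N ->
    forall I1 I2 I3 : {set 'F_p},
      is_Fp_interval p I1 -> is_Fp_interval p I2 -> is_Fp_interval p I3 ->
      #|I1|%:R < (p%:R : R) `^ (8%:R^-1) ->
      #|I2|%:R < (p%:R : R) `^ (8%:R^-1) ->
      #|I3|%:R < (p%:R : R) `^ (8%:R^-1) ->
      c * ((#|I1| * #|I2| * #|I3|)%N%:R : R) `^ (1 - eps)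
        <= (#|prodset3 p I1 I2 I3|%:R : R)
      /\ (#|prodset3 p I1 I2 I3| <= #|I1| * #|I2| * #|I3|)%N.
Proof.
(* This makes 1 / (3 j) smaller than [eps]. *)
pose j := (Num.truncn eps^-1).+1.
have j_eps : eps^-1 < j%:R by rewrite truncnS_gt ?ltW ?invr_gt0.
have [Q Q_gt0 le_Q] := prodset3_card_ge (isT : 0 < j)%N.
exists 0, Q%:R^-1; split=> [|p p_pr _ I1 I2 I3 int1 int2 int3 lt1 lt2 lt3].
  by rewrite invr_gt0 ltr0n.
split; last exact: prodset3_card_le.
have root8 : ((p%:R : R) `^ (8%:R^-1)) ^+ 8 = p%:R.
  by rewrite -powR_mulrn ?powR_ge0 // -powRrM mulVf ?pnatr_eq0 // powRr1.
have lt_nat (n : nat) : n%:R < (p%:R : R) `^ (8%:R^-1) -> (n ^ 8 < p)%N.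
  by move=> lt_n; rewrite -(ltr_nat R) natrX -[ltRHS]root8 ltrXn2r.
have [N_gt0 le_N] := le_Q p p_pr I1 I2 I3 int1 int2 int3
  (lt_nat _ lt1) (lt_nat _ lt2) (lt_nat _ lt3).
set N := (#|I1| * _ * _)%N in N_gt0 le_N *; set P := #|prodset3 _ _ _ _| in le_N *.
rewrite ler_pdivrMl ?ltr0n // -natrM; set k := (3 * j)%N in le_N.
have k_gt0 : 0 < k%:R :> R by rewrite ltr0n.
have N_ge1 : 1 <= N%:R :> R by rewrite ler1n.
(* As N >= 1, the exponent may be raised to 1 - 1 / k; the integer inequality then follows by taking
   k-th roots. *)
apply: (@le_trans _ _ (N%:R `^ (k.-1%:R / k%:R))).
  apply: ler_powR => //; rewrite -subn1 natrB // mulrBl divff ?gt_eqF // lerD2l lerN2 mul1r.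
  rewrite -[leRHS]invrK lef_pV2 ?posrE ?invr_gt0 // (le_trans (ltW j_eps)) // ler_nat.
  by rewrite leq_pmull.
rewrite powRrM powR_mulrn ?ler0n // -natrX.
rewrite -[leRHS](@powRr1 R) ?ler0n // -[X in _ <= _ `^ X](divff (lt0r_neq0 k_gt0)) powRrM.
rewrite powR_mulrn ?ler0n // -natrX ge0_ler_powR ?invr_ge0 ?nnegrE ?ler0n //.
by rewrite ler_nat.
Qed.
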